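(* Let $b\ge2$, $s\ge1$ and $u\ge0$ be integers and let $\mathbf{e}=(e_1,\dots,e_s)\in\mathbb{N}^s$. Let $h$ be the greatest common divisor of $e_1,\dots,e_s$. Then any $(u,\mathbf{e},s)$-sequence in base $b$ is a $(\lceil u/h\rceil,\mathbf{e}/h,s)$-sequence in base $b^h$, where $\mathbf{e}/h=(e_1/h,\dots,e_s/h)$.
   Context: $\mathbb{N}$ denotes the positive integers, $\lambda_s$ Lebesgue measure. An elementary interval in base $b$ is $J=\prod_{i=1}^s[a_ib^{-d_i},(a_i+1)b^{-d_i})$ with integers $d_i\ge0$, $0\le a_i<b^{d_i}$. For integers $0\le u\le m$ and $\mathbf{e}=(e_1,\dots,e_s)\in\mathbb{N}^s$, a set of $b^m$ points in $[0,1)^s$ is a $(u,m,\mathbf{e},s)$-net in base $b$ if every elementary interval $J$ in base $b$ with $\lambda_s(J)\ge b^{u-m}$ and $e_i\mid d_i$ for all $i$ contains exactly $b^m\lambda_s(J)$ of the points. For $\mathbf{x}\in[0,1]^s$, $[\mathbf{x}]_{b,m}$ denotes the coordinatewise $m$-digit truncation of $\mathbf{x}$ in base $b$. For an integer $u\ge0$, a sequence $\mathbf{x}_0,\mathbf{x}_1,\dots$ in $[0,1]^s$ is a $(u,\mathbf{e},s)$-sequence in base $b$ if for all integers $k\ge0$ and $m>u$ the points $[\mathbf{x}_n]_{b,m}$ with $kb^m\le n<(k+1)b^m$ form a $(u,m,\mathbf{e},s)$-net in base $b$. *)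

(* Defs.v *)
From mathcomp Require Import all_boot all_order all_algebra.
From mathcomp Require Import all_classical all_reals all_analysis.
Import Order.TTheory GRing.Theory Num.Theory numFieldNormedType.Exports.

Set Implicit Arguments.
Unset Strict Implicit.
Unset Printing Implicit Defensive.

Local Open Scope classical_set_scope.
Local Open Scope ring_scope.

(* Lebesgue measure on R^n, as an iterated product: the measure of A is the
   integral over the first coordinate of the (n-1)-dimensional measure of the
   sections of A (compare product_measure1, which is only binary); on R^0 it is
   the unit mass at the empty tuple. *)
Fixpoint lebesgue_n (R : realType) (n : nat) : set (n.-tuple R) -> \bar R :=
  match n with
  | 0 => fun A => \d_[tuple] A
  | n'.+1 => fun A =>
      (\int[lebesgue_measure]_(t in setT)
         lebesgue_n [set v : n'.-tuple R | A [tuple of t :: v]])%E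
  end.

Definition elem_interval (R : realType) (b s : nat) (d a : 'I_s -> nat)
    : set (s.-tuple R) :=
  [set x | forall i, tnth x i \in
     `[(a i)%:R / b%:R ^+ d i, ((a i).+1)%:R / b%:R ^+ d i[].

(* The b^m points are an indexed family, so that they are counted with
   multiplicity. *)
Definition is_net (R : realType) (b u m s : nat) (e : 'I_s -> nat)
    (P : 'I_(b ^ m) -> s.-tuple R) : Prop :=
  [/\ (u <= m)%N,
      forall n i, tnth (P n) i \in `[0, 1[ &
      forall d a : 'I_s -> nat,
        (forall i, (a i < b ^ d i)%N) ->
        (forall i, (e i %| d i)%N) ->
        let J := @elem_interval R b s d a in
        ((b%:R ^ (u%:Z - m%:Z))%:E <= lebesgue_n J)%E ->
        ((#|[pred n | P n \in J]|)%:R%:E = (b ^ m)%:R%:E * lebesgue_n J)%E].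

(* a j is the digit of weight b^-(j+1). Expansions ending in digits b - 1 are
   allowed; they are the only ones for x = 1. *)
Definition is_expansion (R : realType) (b : nat) (x : R) (a : nat -> nat)
    : Prop :=
  (forall j, (a j < b)%N) /\
  series (fun j => (a j)%:R / b%:R ^+ j.+1 : R) @ \oo --> x.

Definition trunc (R : realType) (b m s : nat) (a : 'I_s -> nat -> nat)
    : s.-tuple R :=
  [tuple \sum_(j < m) (a i j)%:R / b%:R ^+ j.+1 | i < s].

(* b-adic rationals have two expansions, with different truncations, so a
   sequence comes with prescribed expansions a of the coordinates of its terms;
   the truncation of x n is that of the expansion a n. *)
Definition is_sequence (R : realType) (b u s : nat) (e : 'I_s -> nat)
    (x : nat -> s.-tuple R) (a : nat -> 'I_s -> nat -> nat) : Prop :=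
  [/\ forall n i, tnth (x n) i \in `[0, 1],
      forall n i, is_expansion b (tnth (x n) i) (a n i) &
      forall k m, (u < m)%N ->
        is_net u e (fun n : 'I_(b ^ m) => trunc R b m (a (k * b ^ m + n)%N))].

(* The base b^h expansion obtained from a base b expansion by reading its
   digits in consecutive blocks of length h. *)
Definition regroup (b h : nat) (a : nat -> nat) : nat -> nat :=
  fun j => (\sum_(k < h) a (j * h + k) * b ^ (h - k.+1))%N.

(* The truncation of x itself, as a function of x, is the truncation of this
   expansion, which is not eventually b - 1 unless x = 1. By std_expansionP and
   regroup_std, prescribing std_expansion b everywhere and regrouping amounts to
   using this truncation in base b and in base b^h. *)
Definition std_expansion (R : realType) (b : nat) (x : R) : nat -> nat :=
  fun j => if x < 1 then (Num.truncn (b%:R ^+ j.+1 * x) %% b)%N else b.-1.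

Lemma truncn_mul_div (R : realType) (c : nat) (y : R) :
  (0 < c)%N -> 0 <= y -> (Num.truncn (c%:R * y) %/ c)%N = Num.truncn y.
Proof.
move=> c0 y0; apply/eqP; rewrite eq_sym truncn_eq//.
have cy0 : 0 <= c%:R * y by rewrite mulr_ge0.
have cp : 0 < c%:R :> R by rewrite ltr0n.
apply/andP; split.
  rewrite -(ler_pM2l cp) -natrM.
  by rewrite mulnC -truncn_ge_nat// leq_divM.
rewrite -(ltr_pM2l cp) -natrM -truncn_lt_nat//.
by rewrite mulnC -ltn_divLR.
Qed.

Lemma std_expansionP (R : realType) (b : nat) (x : R) :
  (1 < b)%N -> 0 <= x <= 1 -> is_expansion b x (std_expansion b x).
Proof.
move=> b1 /andP[x0 x1]; have b0 : (0 < b)%N by exact: ltnW.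
have bp k : 0 < (b%:R : R) ^+ k by rewrite exprn_gt0 ?ltr0n.
split=> [j|].
  by rewrite /std_expansion; case: ifP => _; rewrite ?ltn_pmod// ltn_predL.
have bn k : (b%:R : R) ^+ k != 0 by rewrite gt_eqF.
pose S : R^nat := series (fun j => (std_expansion b x j)%:R / b%:R ^+ j.+1).
have SE m : S m * b%:R ^+ m =
    if x < 1 then (Num.truncn (b%:R ^+ m * x))%:R else b%:R ^+ m - 1.
  elim: m => [|m IH].
    rewrite /S /series /= big_geq// mul0r expr0 mul1r; case: ifP => [xl|_].
        by have /eqP -> : Num.truncn x == 0%N by rewrite truncn_eq// x0.
    by rewrite subrr.
  rewrite /S /series /= big_nat_recr//= mulrDl -/(series _ m) divfK ?gt_eqF//.
  rewrite exprSr mulrA [X in X * _]IH /std_expansion; case: ifP => [xl|_].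
    rewrite -natrM -natrD -(truncn_mul_div b0 (mulr_ge0 (ltW (bp m)) x0)).
    by rewrite mulrA -exprS -exprSr -divn_eq.
  by rewrite mulrBl mul1r -subn1 natrB// addrA subrK.
have Sb m : x - b%:R ^- m <= S m <= x.
  rewrite -[X in _ <= X <= _](mulfK (bn m)) SE.
  have -> : x - b%:R ^- m = (b%:R ^+ m * x - 1) / b%:R ^+ m.
    by rewrite mulrBl mul1r mulrAC mulfV ?gt_eqF// mul1r.
  have xE : x = (b%:R ^+ m * x) / b%:R ^+ m.
    by rewrite mulrAC mulfV ?gt_eqF// mul1r.
  rewrite [X in _ <= _ <= X]xE !ler_pM2r ?invr_gt0//.
  have y0 : 0 <= b%:R ^+ m * x by rewrite mulr_ge0// ltW.
  case: ifPn => [xl|].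
    by rewrite lerBlDr natr1 truncn_le y0 ltW// truncnS_gt.
  rewrite -leNgt => x1'; have -> : x = 1 by apply/le_anti; rewrite x1.
  by rewrite mulr1 lexx gerBl ler01.
apply: (@squeeze_cvgr _ _ _ _ (fun m => x - b%:R ^- m) (fun=> x)).
- by near=> m; apply: Sb.
- rewrite -[X in _ --> X]subr0; apply: cvgB; first exact: cvg_cst.
  under eq_fun do rewrite -exprVn.
  by apply: cvg_expr; rewrite ger0_norm ?invr_ge0// invf_lt1 ?ltr0n// ltr1n.
- exact: cvg_cst.
Unshelve. all: by end_near. Qed.

Lemma regroup_std (R : realType) (b h : nat) (x : R) : (1 < b)%N -> 0 <= x ->
  regroup b h (std_expansion b x) = std_expansion (b ^ h) x.
Proof.
move=> b1 x0; have b0 : (0 < b)%N by exact: ltnW.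
have bp k : (0 < b ^ k)%N by rewrite expn_gt0 b0.
apply/funext => j; rewrite /regroup /std_expansion; case: ifPn => [_|_].
  rewrite natrX -exprM [(h * _)%N]mulnC mulSn [(h + _)%N]addnC.
  elim: h (j * h)%N => [|h IH] o; first by rewrite big_ord0 expn0 modn1.
  rewrite big_ord_recl /= subSS subn0 addn0.
  under eq_bigr => k _ do rewrite /bump /= subSS addnA addn1.
  rewrite IH addSnnS.
  set N := Num.truncn (b%:R ^+ (o + h.+1) * x).
  have -> : Num.truncn (b%:R ^+ o.+1 * x) = (N %/ b ^ h)%N.
    rewrite /N addnS -addSn [(o.+1 + h)%N]addnC exprD -mulrA -(natrX _ b h) truncn_mul_div//.
    by rewrite mulr_ge0// exprn_ge0.
  rewrite modn_divl -expnS {2}(divn_eq (N %% b ^ h.+1) (b ^ h)).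
  by rewrite modn_dvdm// expnS dvdn_mull.
rewrite (eq_bigr (fun k : 'I_h => b.-1 * b ^ rev_ord k)%N)//.
rewrite -big_distrr /= predn_exp; congr (_ * _)%N.
rewrite (reindex_inj rev_ord_inj); apply: eq_bigr => k _.
by rewrite -[X in (b ^ X = _)%N]/(nat_of_ord (rev_ord (rev_ord k))) rev_ordK.
Qed.

(* Main.v *)
Require Import Defs.
From mathcomp Require Import all_boot all_order all_algebra.
From mathcomp Require Import all_classical all_reals all_analysis.
Import Order.TTheory GRing.Theory Num.Theory.
Local Open Scope ring_scope.

(** Reading digits in blocks of length [h], the [m]-digit truncation in base
    [b ^ h] is the [h * m]-digit truncation in base [b], and an elementary
    interval in base [b ^ h] with exponents [d] is one in base [b] with exponents
    [h * d].  Both net conditions therefore concern the same points and intervals,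
    and [u <= h * t] makes the volume bound in base [b ^ h] the stronger one. *)

Lemma regroup_lt (b h : nat) (a : nat -> nat) (j : nat) :
  (forall k, (a k < b)%N) -> (regroup b h a j < b ^ h)%N.
Proof.
(* The offset [j * h] is generalized to [o], since peeling off the leading digit shifts the rest of
   the block by one. *)
move=> ab; rewrite /regroup; elim: h (j * h)%N => [|h IH] o.
  by rewrite big_ord0 expn0.
rewrite big_ord_recl /= subSS subn0 addn0.
under eq_bigr => k _ do rewrite /bump /= subSS addnA addn1.
rewrite (@leq_trans ((a o).+1 * b ^ h)%N)//; last by rewrite expnS leq_mul.
by rewrite mulSn addnC ltn_add2r.
Qed.

Lemma regroup_weight (R : realType) (b h : nat) (a : nat -> nat) (j : nat) :
  (0 < b)%N ->
  (regroup b h a j)%:R / (b ^ h)%:R ^+ j.+1 =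
  \sum_(k < h) (a (j * h + k)%N)%:R / b%:R ^+ (j * h + k).+1 :> R.
Proof.
move=> b0; have bn k : (b%:R : R) ^+ k != 0 by rewrite expf_neq0// pnatr_eq0 -lt0n.
rewrite /regroup natr_sum mulr_suml; apply: eq_bigr => k _.
(* The first factor cancels the weight that digit [k] carries inside its block. *)
have -> : (b ^ h)%:R ^+ j.+1 = b%:R ^+ (h - k.+1) * b%:R ^+ (j * h + k).+1 :> R.
  rewrite natrX -exprM -exprD; congr (_ ^+ _).
  by rewrite mulnS mulnC -addnS addnCA subnK// addnC.
by rewrite natrM natrX invfM mulrA mulfK.
Qed.

Lemma regroup_sum (R : realType) (b h : nat) (a : nat -> nat) (m : nat) :
  (0 < b)%N ->
  \sum_(j < m) (regroup b h a j)%:R / (b ^ h)%:R ^+ j.+1 =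
  \sum_(j < m * h) (a j)%:R / b%:R ^+ j.+1 :> R.
Proof.
move=> b0; elim: m => [|m IH]; first by rewrite mul0n !big_ord0.
by rewrite big_ord_recr /= IH mulSn addnC big_split_ord /= regroup_weight.
Qed.

Lemma regroup_trunc (R : realType) (b h m s : nat) (a : 'I_s -> nat -> nat) :
  (0 < b)%N ->
  trunc R (b ^ h) m (fun i => regroup b h (a i)) = trunc R b (h * m) a.
Proof.
by move=> b0; apply: eq_from_tnth => i; rewrite !tnth_mktuple regroup_sum// mulnC.
Qed.

(** The partial sums of the regrouped series are those of the original one at multiples of [h], a
    subsequence because [0 < h]. *)
Lemma regroup_expansion (R : realType) (b h : nat) (x : R) (a : nat -> nat) :
  (0 < b)%N -> (0 < h)%N ->
  is_expansion b x a -> is_expansion (b ^ h) x (regroup b h a).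
Proof.
move=> b0 h0 [ab ax]; split=> [j|]; first exact: regroup_lt.
have -> : series (fun j => (regroup b h a j)%:R / (b ^ h)%:R ^+ j.+1 : R) =
    series (fun j => (a j)%:R / b%:R ^+ j.+1) \o (fun m => (m * h)%N).
  by apply/funext => m; rewrite /series /= !big_mkord regroup_sum.
apply: cvg_comp ax => A [N _ NA].
by exists N => // n /= Nn; apply: NA; rewrite /= (leq_trans Nn)// leq_pmulr.
Qed.

Lemma elem_interval_expn (R : realType) (b h s : nat) (d a : 'I_s -> nat) :
  @elem_interval R (b ^ h) s d a = elem_interval b (fun i => h * d i)%N a.
Proof.
by rewrite /elem_interval; under eq_fun do under eq_forall do
  rewrite natrX -exprM.
Qed.

(** Transports the point count between the index types of sizes [(b ^ h) ^ m] and [b ^ (h * m)],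
    which are equal only propositionally. For the same reason [P] is indexed by [nat] in
    [is_net_expn]. *)
Lemma card_ord_pred_eq (N M : nat) (p : pred nat) :
  N = M -> #|[pred n : 'I_N | p n]| = #|[pred n : 'I_M | p n]|.
Proof. by move=> ->. Qed.

Lemma is_net_expn (R : realType) (b h u t m s : nat) (e : 'I_s -> nat)
    (P : nat -> s.-tuple R) :
  (0 < b)%N -> (forall i, h %| e i)%N -> (u <= h * t)%N -> (t <= m)%N ->
  is_net u e (fun n : 'I_(b ^ (h * m)) => P n) ->
  is_net t (fun i => e i %/ h)%N (fun n : 'I_((b ^ h) ^ m) => P n).
Proof.
move=> b0 he ut tm [_ P01 Pnet]; have EM : ((b ^ h) ^ m = b ^ (h * m))%N by rewrite expnM.
split=> // [n i|d a ad ed J].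
  by have := P01 (cast_ord EM n) i.
rewrite /J elem_interval_expn => bJ.
rewrite (card_ord_pred_eq _ _ (fun n => P n \in _) EM) EM.
apply: Pnet => [i|i|].
- by rewrite expnM.
- by rewrite -(divnK (he i)) mulnC dvdn_mul.
(* What remains is [u - h * m <= h * (t - m)] between exponents, which is [u <= h * t]. *)
- apply: le_trans bJ; rewrite lee_fin natrX exprnP exprz_exp.
  rewrite ler_weXz2l ?ler1n// mulrBr -!PoszM lerB// lez_nat.
Qed.

Lemma leq_mul_absz_ceil (u h : nat) :
  (0 < h)%N -> (u <= h * `|Num.ceil (u%:R / h%:R : rat)|)%N.
Proof.
move=> h0; have hp : 0 < h%:R :> rat by rewrite ltr0n.
(* Nonnegativity ensures that the absolute value leaves the ceiling unchanged. *)
have c0 : 0 <= Num.ceil (u%:R / h%:R : rat).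
  by rewrite -(ler_int rat) (le_trans _ (ceil_ge _))// divr_ge0.
rewrite -(ler_nat rat) natrM mulrC -ler_pdivrMr//.
by rewrite (le_trans (ceil_ge _))// -{1}(gez0_abs c0).
Qed.

Theorem theorem5 (R : realType) (b s u : nat) (e : 'I_s -> nat)
    (hb : (2 <= b)%N) (hs : (1 <= s)%N) (he : forall i, (0 < e i)%N) :
  let h := (\big[gcdn/0]_(i < s) e i)%N in
  forall (x : nat -> s.-tuple R) (a : nat -> 'I_s -> nat -> nat),
    is_sequence b u e x a ->
    is_sequence (b ^ h) `|Num.ceil (u%:R / h%:R : rat)|%N
      (fun i => (e i %/ h)%N) x (fun n i => regroup b h (a n i)).
Proof.
move=> h x a [x01 xa anet].
have b0 : (0 < b)%N by exact: ltnW.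
have hdvd i : (h %| e i)%N by rewrite /h (bigD1 i)//= dvdn_gcdl.
(* [hs] supplies a coordinate, whose positive exponent [h] divides; an empty gcd would be 0. *)
have h0 : (0 < h)%N by apply: dvdn_gt0 (hdvd (Ordinal hs)).
have ut := leq_mul_absz_ceil u h h0.
split=> // [n i|k m tm]; first exact: regroup_expansion.
(* This makes the base [b] hypothesis available at level [h * m], for the same block index [k]. *)
have um : (u < h * m)%N by rewrite (leq_ltn_trans ut)// ltn_pmul2l.
pose P n := trunc R b (h * m) (a (k * b ^ (h * m) + n)%N).
rewrite [X in is_net _ _ X](_ : _ = fun n : 'I_((b ^ h) ^ m) => P n); last first.
  by apply/funext => n; rewrite regroup_trunc// /P expnM.
by apply: is_net_expn ut (ltnW tm) _ => //; exact: anet.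
Qed.
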